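(* Let $\Phi(k,n)$ denote the number of isomorphism classes of (untwisted, multiplicity one) fission trees of slope $\le k$ with $n$ leaves. Then: 1) For all $n\ge 1$, $\Phi(2,n)=p(n)$ is the number of integer partitions of $n$. 2) For any fixed integer $k\ge 1$ the sequence $(\Phi(k,n))_{n\ge 1}$ is the Euler transform of the sequence $(\Phi(k-1,n))_{n\ge 1}$.
   Context: An (untwisted, multiplicity one) fission tree is given by a sequence of nonempty finite sets and surjective maps $$J_1\twoheadrightarrow J_2\twoheadrightarrow J_3\twoheadrightarrow\cdots$$ with $|J_i|=1$ for all sufficiently large $i$. (Here $J_i$ is the set of nodes of height $i$ of the tree and the maps send a node to its parent; each node of $J_1$ has exactly one child, a leaf of height $0$, so the leaves are identified with $J_1$.) The number of leaves is $|J_1|$ and the slope is $\min\{i-1 : i\ge 1,\ |J_i|=1\}\ge 0$. An isomorphism between two fission trees is a family of bijections $J_i\to J_i'$ ($i\ge1$) commuting with the surjective maps. The Euler transform of an integer sequence $a_1,a_2,a_3,\ldots$ is the integer sequence $(b_n)_{n\ge1}$ given by the identity of formal power series $1+\sum_{n=1}^\infty b_nu^n=\prod_{m=1}^\infty(1-u^m)^{-a_m}$. *)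

(* Defs.v *)
From HB Require Import structures.
From mathcomp Require Import all_boot all_order all_algebra finmap.
From mathcomp Require Import boolp classical_sets functions cardinality.

Set Implicit Arguments.
Unset Strict Implicit.
Unset Printing Implicit Defensive.

Import GRing.Theory.

Local Open Scope classical_set_scope.
Local Open Scope ring_scope.

(* [node i] is the set J_(i+1) of nodes of height i+1; in particular [node 0]
   is J_1, which is identified with the set of leaves. *)
Record fission_tree := FissionTree {
  node : nat -> finType;
  parent : forall i, node i -> node i.+1;
  node_gt0 : forall i, (0 < #|node i|)%N;
  parent_surj : forall i (y : node i.+1), exists x : node i, parent x = y;
  node_eventually1 : exists N, forall i, (N <= i)%N -> #|node i| = 1%N
}.

Definition leaves (T : fission_tree) : nat := #|node T 0|.

Fact slope_subproof (T : fission_tree) : exists i, #|node T i| == 1%N.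
Proof. by have [N TN] := node_eventually1 T; exists N; rewrite TN. Qed.

(* The index shift in [node] accounts for the -1 in min {i - 1 | #|J_i| = 1}. *)
Definition slope (T : fission_tree) : nat := ex_minn (slope_subproof T).

Definition fission_iso (T T' : fission_tree) : Prop :=
  exists phi : forall i, node T i -> node T' i,
    (forall i, bijective (phi i)) /\
    (forall i (x : node T i), phi i.+1 (parent x) = parent (phi i x)).

Lemma fission_iso_sym T T' : fission_iso T T' -> fission_iso T' T.
Proof.
move=> [phi [phi_bij phiP]].
have ex i : exists g, cancel (phi i) g /\ cancel g (phi i).
  by case: (phi_bij i) => g; exists g.
pose psi i := projT1 (cid (ex i)).
have phiK i : cancel (phi i) (psi i) by case: (projT2 (cid (ex i))).
have psiK i : cancel (psi i) (phi i) by case: (projT2 (cid (ex i))).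
exists psi; split=> [i|i x]; first by exists (phi i).
by apply: (can_inj (phiK i.+1)); rewrite phiP !psiK.
Qed.

Lemma fission_iso_trans T2 T1 T3 :
  fission_iso T1 T2 -> fission_iso T2 T3 -> fission_iso T1 T3.
Proof.
move=> [phi [phi_bij phiP]] [psi [psi_bij psiP]].
exists (fun i => psi i \o phi i); split=> [i|i x /=]; first exact: bij_comp.
by rewrite phiP psiP.
Qed.

(* There are exactly N isomorphism classes: [r] is a system of representatives.
   For universe reasons, [set fission_tree] is not well-typed, whence this
   formulation instead of a cardinal of a set of classes. *)
Definition class_count (k n N : nat) : Prop :=
  exists r : 'I_N -> fission_tree,
    [/\ forall i, (slope (r i) <= k)%N /\ leaves (r i) = n,
        forall i j, fission_iso (r i) (r j) -> i = j
      & forall T, (slope T <= k)%N -> leaves T = n ->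
          exists i, fission_iso T (r i)].

Lemma class_count_uniq k n N N' :
  class_count k n N -> class_count k n N' -> N = N'.
Proof.
suff le M M' : class_count k n M -> class_count k n M' -> (M <= M')%N.
  by move=> hN hN'; apply/eqP; rewrite eqn_leq !le.
move=> [r [rP r_inj _]] [r' [_ _ r'P]].
have ex i : exists j, fission_iso (r i) (r' j) by case: (rP i) => /r'P h /h.
have [f fP] := choice ex.
rewrite -[M]card_ord -[M']card_ord; apply: (@leq_card _ _ f) => i j fij.
by apply/r_inj/(fission_iso_trans (fP i)); rewrite fij; exact/fission_iso_sym.
Qed.

(* The default value 0 is used only if there are infinitely many classes. *)
Definition Phi (k n : nat) : nat := xget 0%N [set N | class_count k n N].

Definition is_partition (n : nat) (s : seq nat) : Prop :=
  [/\ sorted geq s, 0%N \notin s & sumn s = n].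

Lemma finite_partition n : finite_set [set s | is_partition n s].
Proof.
pose f (t : n.-bseq 'I_n.+1) : seq nat := map val t.
apply: (@sub_finite_set _ _ (f @` setT)); last exact: finite_image.
move=> s /= [_ s0 sn].
have le_n x : x \in s -> (x < n.+1)%N.
  rewrite ltnS -sn => {s0 sn}; elim: s => //= y s IHs.
  rewrite inE => /orP[/eqP->|/IHs xs]; first exact: leq_addr.
  exact: leq_trans xs (leq_addl _ _).
have sz : (size [seq inord i : 'I_n.+1 | i <- s] <= n)%N.
  rewrite size_map -sn => {sn le_n}; elim: s s0 => //= y s IHs.
  rewrite inE negb_or eq_sym -lt0n => /andP[y0 /IHs le_s].
  by rewrite -add1n leq_add.
exists (Bseq sz) => //=; rewrite /f /= -map_comp -[RHS]map_id.
by apply/eq_in_map => x /le_n xn /=; rewrite inordK.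
Qed.

Definition npartitions (n : nat) : nat := #|` fset_set [set s | is_partition n s]|.

(* Formal power series, represented by their coefficients. *)
Record fps (R : Type) := Fps { fcoef : nat -> R }.

Lemma fpsP (R : Type) (f g : fps R) : fcoef f =1 fcoef g <-> f = g.
Proof. by split=> [|-> //]; case: f g => [f] [g] /= /funext->. Qed.

HB.instance Definition _ (R : Type) := gen_eqMixin (fps R).
HB.instance Definition _ (R : Type) := gen_choiceMixin (fps R).

Section FpsRing.
Variable R : comNzRingType.
Implicit Types f g h : fps R.

Definition fps_zero : fps R := Fps (fun=> 0).
Definition fps_opp f : fps R := Fps (fun n => - fcoef f n).
Definition fps_add f g : fps R := Fps (fun n => fcoef f n + fcoef g n).

Fact fps_addA : associative fps_add.
Proof. by move=> f g h; apply/fpsP => n /=; rewrite addrA. Qed.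
Fact fps_addC : commutative fps_add.
Proof. by move=> f g; apply/fpsP => n /=; rewrite addrC. Qed.
Fact fps_add0 : left_id fps_zero fps_add.
Proof. by move=> f; apply/fpsP => n /=; rewrite add0r. Qed.
Fact fps_addN : left_inverse fps_zero fps_opp fps_add.
Proof. by move=> f; apply/fpsP => n /=; rewrite addNr. Qed.

HB.instance Definition _ :=
  GRing.isZmodule.Build (fps R) fps_addA fps_addC fps_add0 fps_addN.

Definition fps_one : fps R := Fps (fun n => (n == 0%N)%:R).
Definition fps_mul f g : fps R :=
  Fps (fun n => \sum_(i < n.+1) fcoef f i * fcoef g (n - i)%N).

Definition fps_trunc N f : {poly R} := \poly_(i < N.+1) fcoef f i.

Lemma coef_fps_trunc N f i : (i <= N)%N -> (fps_trunc N f)`_i = fcoef f i.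
Proof. by move=> iN; rewrite coef_poly ltnS iN. Qed.

Lemma coef_fps_truncM N f g i : (i <= N)%N ->
  (fps_trunc N f * fps_trunc N g)`_i = fcoef (fps_mul f g) i.
Proof.
move=> iN; rewrite coefM; apply: eq_bigr => j _.
rewrite !coef_fps_trunc //; first exact: leq_trans (leq_subr _ _) iN.
by apply: leq_trans iN; rewrite -ltnS.
Qed.

Fact fps_mulA : associative fps_mul.
Proof.
move=> f g h; apply/fpsP => n.
transitivity (fps_trunc n f * (fps_trunc n g * fps_trunc n h))`_n.
  rewrite coefM; apply: eq_bigr => j _.
  by rewrite coef_fps_trunc -1?ltnS // coef_fps_truncM // leq_subr.
rewrite mulrA coefM; apply: eq_bigr => j _.
by rewrite coef_fps_trunc ?leq_subr // coef_fps_truncM // -ltnS.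
Qed.

Fact fps_mulC : commutative fps_mul.
Proof.
by move=> f g; apply/fpsP => n; rewrite -!(@coef_fps_truncM n) // mulrC.
Qed.

Fact fps_mul1 : left_id fps_one fps_mul.
Proof.
move=> f; apply/fpsP => n /=; rewrite big_ord_recl /= mul1r subn0.
by rewrite big1 ?addr0 // => i _; rewrite mul0r.
Qed.

Fact fps_mulDl : left_distributive fps_mul fps_add.
Proof.
move=> f g h; apply/fpsP => n /=; rewrite -big_split /=.
by apply: eq_bigr => i _; rewrite mulrDl.
Qed.

Fact fps_one_neq0 : fps_one != 0.
Proof.
by apply/eqP => /fpsP/(_ 0%N) /= /eqP; rewrite oner_eq0.
Qed.

HB.instance Definition _ := GRing.Zmodule_isComNzRing.Build (fps R)
  fps_mulA fps_mulC fps_mul1 fps_mulDl fps_one_neq0.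

Definition fps_unit : {pred fps R} := fun f => `[< exists g, g * f = 1 >].
Definition fps_inv f : fps R :=
  if pselect (exists g, g * f = 1) is left ex then projT1 (cid ex) else f.

Fact fps_mulVx : {in fps_unit, left_inverse 1 fps_inv *%R}.
Proof.
move=> f /asboolP fU; rewrite /fps_inv; case: pselect => // ex.
by case: (cid ex).
Qed.
Fact fps_unitPl f g : g * f = 1 -> fps_unit f.
Proof. by move=> gf; apply/asboolP; exists g. Qed.
Fact fps_inv_out : {in [predC fps_unit], fps_inv =1 id}.
Proof.
by move=> f /asboolP fU; rewrite /fps_inv; case: pselect.
Qed.

HB.instance Definition _ := GRing.ComNzRing_hasMulInverse.Build (fps R)
  fps_mulVx fps_unitPl fps_inv_out.

Definition fpsX : fps R := Fps (fun n => (n == 1%N)%:R).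

Lemma fcoefXn m n : fcoef (fpsX ^+ m) n = (n == m)%:R.
Proof.
elim: m n => [|m IHm] n; first by rewrite expr0.
rewrite exprS; case: n => [|n] /=; first by rewrite big_ord1 /= mul0r.
rewrite big_ord_recl mul0r add0r big_ord_recl /= mul1r IHm subSS subn0 eqSS.
by rewrite big1 ?addr0 // => i _; rewrite mul0r.
Qed.

(* Hence the negative powers of 1 - u^m are genuine ones, not default values. *)
Lemma fps_unit_1subXn m : (0 < m)%N -> 1 - fpsX ^+ m \is a GRing.unit.
Proof.
move=> m0; pose g : fps R := Fps (fun n => (m %| n)%:R).
apply/asboolP; exists g; rewrite mulrBr mulr1; apply/fpsP => n.
rewrite -[LHS]/(fcoef g n - fcoef (g * fpsX ^+ m) n) mulrC.
rewrite -[fcoef (_ * g) n]/(\sum_(i < n.+1) fcoef (fpsX ^+ m) i * _).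
have [nm|mn] := ltnP n m.
  rewrite big1 ?subr0 /= => [|i _].
    by case: n nm => [|n] nm; rewrite ?dvdn0 // gtnNdvd.
  by rewrite fcoefXn (ltn_eqF (leq_trans (ltn_ord i) nm)) mul0r.
rewrite (bigD1 (Ordinal (mn : (m < n.+1)%N))) //= big1 => [|i im]; last first.
  by rewrite fcoefXn (negPf (im : (i : nat) != m)) mul0r.
rewrite fcoefXn eqxx mul1r addr0 dvdn_subl // subrr.
by rewrite (gtn_eqF (leq_trans m0 mn)).
Qed.

(* Coefficientwise stabilisation of the partial products over 1 <= m < N. *)
Definition fps_infprod (F : nat -> fps R) (P : fps R) : Prop :=
  forall n, exists N0, forall N, (N0 <= N)%N ->
    fcoef (\prod_(1 <= m < N) F m) n = fcoef P n.

End FpsRing.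

(* Sequences are indexed from 1: the values [a 0] and [b 0] are irrelevant. *)
Definition is_euler_transform (a b : nat -> int) : Prop :=
  fps_infprod (fun m => (1 - fpsX int ^+ m) ^ (- a m))
              (Fps (fun n => if n == 0%N then 1 else b n)).

(* Main.v *)
Require Import Defs.
From mathcomp Require Import all_boot all_order perm all_algebra finmap.
From mathcomp Require Import boolp classical_sets functions cardinality.

Set Implicit Arguments.
Unset Strict Implicit.
Unset Printing Implicit Defensive.

Import GRing.Theory.

(** What lies below a node is determined, up to isomorphism, by the multiset of
the isomorphism classes of what lies below its children. Write this down
recursively: the code of a leaf is 0, and the code of a higher node is the
sorted list of the codes of its children, packed into a natural number by the
bijection [CodeSeq.code] between [seq nat] and [nat], so that all heights share
one type of codes. A tree T of slope at most k has a single node in [node T k],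
and the code of that node

- is a complete isomorphism invariant ([ncode_iso], [iso_of_ncode]): equality
  of multisets of codes of children lets one choose the bijections of an
  isomorphism level by level from the top;
- can be any code that is hereditarily sorted and nonempty ([ncode_valid],
  [tree_ofP]): graft trees realizing the entries of the list onto a new node;
- determines the number of leaves ([weight_ncode]).

Hence [Phi k n] counts the valid codes of depth k and weight n ([Phi_enum]).

A valid code of depth k + 1 is a nonempty multiset of valid codes of depth k,
with additive weight. Multisets drawn from a finite list vs of objects with
positive weights w have the generating function given by the product over vs
of 1 / (1 - u^(w v)): either v does not occur, or one copy of it can be removed
([enum_multisets]). Collecting the factors by weight turns this product into
the product of the (1 - u^m)^(- Phi k m), which is the Euler transform
([Phi_euler]). Only objects of weight at most n matter for the coefficient of
u^n, so finite products suffice.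

For slope at most 1 there is exactly one class for each number of leaves
([Phi1]). So the generating function of [Phi 2] is the product of all the
1 / (1 - u^m), which also counts the multisets of positive integers, that is,
partitions ([Phi2_partitions]). *)

(** * Canonical codes of nodes *)

Definition child_codes (T : fission_tree) i (c : node T i -> nat)
    (y : node T i.+1) : seq nat :=
  [seq c x | x <- enum (node T i) & parent x == y].

Fixpoint ncode (T : fission_tree) i : node T i -> nat :=
  match i with
  | 0 => fun=> 0
  | i'.+1 => fun y => CodeSeq.code (sort leq (child_codes (@ncode T i') y))
  end.

(** The codes of nodes are the hereditarily nonempty and sorted ones: by
surjectivity of [parent] every node of positive height index has a child. *)
Fixpoint valid k c : bool :=
  if k is k'.+1 then
    let s := CodeSeq.decode c in
    [&& s != [::], sorted leq s & all (valid k') s]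
  else c == 0.

Fixpoint weight k c : nat :=
  if k is k'.+1 then sumn (map (weight k') (CodeSeq.decode c)) else 1.

Lemma weight_gt0 k c : valid k c -> 0 < weight k c.
Proof.
elim: k c => //= k IHk c; case: (CodeSeq.decode c) => //= d s.
by case/and3P=> _ /IHk d0 _; rewrite addn_gt0 d0.
Qed.

Lemma ncode_valid T i (x : node T i) : valid i (ncode x).
Proof.
elim: i x => //= i IHi y; rewrite CodeSeq.codeK sort_sorted; last exact: leq_total.
rewrite all_sort all_map; apply/and3P; split=> //.
  rewrite -size_eq0 size_sort size_map size_filter -lt0n -has_count.
  have [x xy] := parent_surj y.
  by apply/hasP; exists x; rewrite ?mem_enum //= xy.
by apply/allP => x _ /=.
Qed.

(** The weight of a code counts the leaves below the node, and every leaf lies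
below exactly one node of each height. *)
Lemma weight_ncode T i : \sum_(x : node T i) weight i (ncode x) = leaves T.
Proof.
elim: i => [|i <-]; first by rewrite /= sum1_card.
rewrite (partition_big (@parent T i) predT) //=.
apply: eq_bigr => y _; rewrite CodeSeq.codeK.
rewrite (perm_sumn (perm_map _ (permEl (perm_sort _ _)))).
by rewrite /child_codes -map_comp sumnE big_map big_filter big_enum_cond.
Qed.

Lemma some_nodeP (T : fission_tree) i : {x : node T i | true}.
Proof. by apply: sigW; have /card_gt0P[x _] := node_gt0 T i; exists x. Qed.

Definition some_node (T : fission_tree) i : node T i := sval (some_nodeP T i).

(** Surjectivity makes the number of nodes nonincreasing in the height, so once
a level is a singleton all higher ones are. *)
Lemma slope_leP (T : fission_tree) k :
  reflect (#|node T k| = 1) (slope T <= k).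
Proof.
rewrite /slope; case: ex_minnP => m /eqP Tm minm.
apply: (iffP idP) => [|Tk]; last by apply: minm; rewrite Tk.
elim: k => [|k IHk]; first by move: Tm; rewrite leqn0 => + /eqP m0; rewrite m0.
rewrite leq_eqVlt => /predU1P[<- //|/IHk Tk].
apply/eqP; rewrite eqn_leq node_gt0 andbT -Tk.
have -> : #|node T k.+1| = #|codom (@parent T k)|.
  apply/esym/eq_card => y; rewrite !inE; apply/codomP.
  by have [x <-] := parent_surj y; exists x.
exact: leq_image_card.
Qed.

Lemma card1_eq (A : finType) (x y : A) : #|A| = 1 -> x = y.
Proof. by move=> A1; apply: (fintype_le1P _); rewrite A1. Qed.

Lemma ncode_iso T T' (phi : forall i, node T i -> node T' i) :
  (forall i, bijective (phi i)) ->
  (forall i (x : node T i), phi i.+1 (parent x) = parent (phi i x)) ->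
  forall i x, ncode (phi i x) = ncode x.
Proof.
move=> phi_bij phiP; elim=> //= i IHi y; congr CodeSeq.code.
apply/perm_sortP; [exact: leq_total|exact: leq_trans|exact: anti_leq|].
have [g phiK gK] := phi_bij i.
have /(perm_filter (fun x' => parent x' == phi i.+1 y))/(perm_map (@ncode T' i)) :
    perm_eq (enum (node T' i)) (map (phi i) (enum (node T i))).
  apply: uniq_perm; first exact: enum_uniq.
    by rewrite map_inj_uniq; [exact: enum_uniq|exact: can_inj phiK].
  by move=> x'; rewrite mem_enum -[x']gK map_f // mem_enum.
move/perm_trans; apply; rewrite filter_map -map_comp.
rewrite (eq_map (IHi : _ =1 _)).
rewrite (@eq_filter _ _ (fun x => parent x == y)) // => x /=.
by rewrite -phiP (bij_eq (phi_bij _)).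
Qed.

(** Two maps that take each value equally often differ by a bijection of their
sources. *)
Lemma bij_of_perm_codom (A B : finType) (Z : eqType) (f : A -> Z) (g : B -> Z) :
  perm_eq (codom f) (codom g) -> exists2 h : A -> B, bijective h & g \o h =1 f.
Proof.
move=> pfg; have AB : #|A| = #|B|.
  by have := perm_size pfg; rewrite !size_codom.
have /tuple_permP[p fE] : perm_eq (codom f) (codom_tuple g) by [].
pose h a := enum_val (p (cast_ord AB (enum_rank a))).
exists h => [|a /=].
  apply: inj_card_bij; last by rewrite AB.
  by move=> a b /enum_val_inj/perm_inj/cast_ord_inj/enum_rank_inj.
have -> : f a = nth (f a) (codom f) (enum_rank a) by rewrite nth_codom enum_rankK.
rewrite fE /= (nth_map (cast_ord AB (enum_rank a))) ?size_enum_ord; last first.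
  by rewrite -AB.
rewrite (tnth_nth (f a)) nth_codom /h.
congr (g (enum_val (p _))); apply: val_inj => /=.
by rewrite nth_enum_ord // -AB.
Qed.

(** One step down in the construction of an isomorphism. Corresponding nodes of
height index m + 1 have the same code, hence children with the same codes, with
multiplicity. So pairing (image of the parent, code of the node) takes every
value equally often in both trees, and a bijection respecting these pairs
extends the isomorphism and preserves codes again. *)
Lemma iso_extend T T' m (phi : forall i, node T i -> node T' i) :
    (forall i, m < i -> bijective (phi i)) ->
    (forall i (x : node T i), m < i -> phi i.+1 (parent x) = parent (phi i x)) ->
    (forall x, ncode (phi m.+1 x) = ncode x) ->
  exists psi : forall i, node T i -> node T' i,
    [/\ forall i, m <= i -> bijective (psi i),
        forall i (x : node T i), m <= i -> psi i.+1 (parent x) = parent (psi i x)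
      & forall x, ncode (psi m x) = ncode x].
Proof.
move=> phi_bij phiP phic.
have [|h h_bij hP] := @bij_of_perm_codom _ _ _
    (fun x : node T m => (phi m.+1 (parent x), ncode x))
    (fun x' : node T' m => (parent x', ncode x')).
  apply/allP => -[y' c] _ /=; apply/eqP.
  (* Both multiplicities of (y', c) count children with code c, of the node
     g y' in T and of y' in T'. *)
  have [g phiK gK] := phi_bij m.+1 (ltnSn m).
  have /(congr1 CodeSeq.decode) := phic (g y'); rewrite /= !CodeSeq.codeK gK.
  move/perm_sortP => /(_ leq_total leq_trans anti_leq)/seq.permP/(_ (pred1 c)).
  rewrite /child_codes !enumT !count_map !count_filter => /esym E.
  apply: etrans (etrans E _).
    apply: eq_count => x /=; rewrite xpair_eqE andbC; congr (_ && _).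
    by rewrite (can2_eq phiK gK).
  by apply: eq_count => x' /=; rewrite xpair_eqE andbC.
have psiE j : m < j -> dfwith phi h j = phi j.
  by move=> mj; rewrite dfwith_out // ltn_eqF.
exists (dfwith phi h); split=> [i mi|i x mi|x].
- case: (ltngtP m i) mi => // [mi _|<- _]; last by rewrite dfwith_in.
  by rewrite psiE //; exact: phi_bij.
- case: (ltngtP m i) x mi => // [mi x _|<- x _].
    by rewrite !psiE ?phiP // ltnW.
  by rewrite dfwith_in psiE //; case: (hP x) => ->.
- by rewrite dfwith_in; case: (hP x).
Qed.

(** From the level k on, both trees have one node per level and there is nothing
to choose; below it, [iso_extend] descends one level at a time. *)
Lemma iso_of_ncode T T' k (x : node T k) (x' : node T' k) :
  slope T <= k -> slope T' <= k -> ncode x = ncode x' -> fission_iso T T'.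
Proof.
move=> Tk T'k xx'.
suff H j : j <= k -> exists phi : forall i, node T i -> node T' i,
    [/\ forall i, k - j <= i -> bijective (phi i),
        forall i (x : node T i), k - j <= i ->
          phi i.+1 (parent x) = parent (phi i x)
      & forall x, ncode (phi (k - j) x) = ncode x].
  have [phi []] := H k (leqnn k); rewrite subnn => phi_bij phiP _.
  by exists phi; split=> *; [exact: phi_bij|exact: phiP].
elim: j => [_|j IHj jk].
  rewrite subn0; exists (fun i=> fun=> some_node T' i).
  have T1 i : k <= i -> #|node T i| = 1.
    by move=> ki; apply/slope_leP/(leq_trans Tk).
  have T'1 i : k <= i -> #|node T' i| = 1.
    by move=> ki; apply/slope_leP/(leq_trans T'k).
  split=> [i ki|i y ki|y].
  - by exists (fun=> some_node T i) => y; apply: card1_eq; auto.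
  - by apply: card1_eq; apply: T'1; exact: leqW.
  - by rewrite (card1_eq y x (T1 k _)) // xx'; congr ncode; apply/card1_eq/T'1.
have [phi [phi_bij phiP phic]] := IHj (ltnW jk).
have kj : k - j = (k - j.+1).+1 by rewrite subnSK.
move: phi_bij phiP phic; rewrite kj; exact: iso_extend.
Qed.

(** * Realizing a code by a tree *)

(** Glue m + 1 given trees, each cut above the level k, along the part of the
first of them above the level k, its trunk; if that tree has slope at most k,
this hangs all of them from one new node of height index k + 1. Using a trunk
keeps all levels subtypes of the same disjoint unions, so that no level is
defined by cases on types, and it asks nothing of the slopes of the trees. *)
Section Graft.
Variables (k m : nat) (T : 'I_m.+1 -> fission_tree).

Definition graft_node i : finType :=
  {p : {j : 'I_m.+1 & node (T j) i} | (i <= k) || (tag p == ord0)}.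

Definition graft_mk i j (x : node (T j) i) (ij : (i <= k) || (j == ord0)) :
  graft_node i := Sub (Tagged (fun j => node (T j) i) x) ij.

Fact graft_root i : (i <= k) || (ord0 == ord0 :> 'I_m.+1).
Proof. by rewrite orbT. Qed.

Definition graft_parent i (p : graft_node i) : graft_node i.+1 :=
  let: existT j x := val p in
  if (i < k) || (j == ord0) =P true is ReflectT ij then graft_mk (parent x) ij
  else graft_mk (some_node (T ord0) i.+1) (graft_root i.+1).

Lemma graft_parentE i j (x : node (T j) i) ij (ij' : (i < k) || (j == ord0)) :
  graft_parent (graft_mk x ij) = graft_mk (parent x) ij'.
Proof.
by rewrite /graft_parent /=; case: eqP => // ij2; rewrite (eq_irrelevance ij2 ij').
Qed.

Lemma graft_nodeP i (p : graft_node i) :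
  exists j (x : node (T j) i) (ij : (i <= k) || (j == ord0)), p = graft_mk x ij.
Proof. by case: p => -[j x] ij; exists j, x, ij; apply: val_inj. Qed.

Fact graft_gt0 i : 0 < #|graft_node i|.
Proof.
by apply/card_gt0P; exists (graft_mk (some_node (T ord0) i) (graft_root i)).
Qed.

Fact graft_surj i (y : graft_node i.+1) : exists x, graft_parent x = y.
Proof.
have [j [y' [ij ->]]] := graft_nodeP y; have [x xy'] := parent_surj y'.
have ij' : (i <= k) || (j == ord0) by case/orP: ij => [/ltnW->|->]; rewrite ?orbT.
by exists (graft_mk x ij'); rewrite (graft_parentE x ij' ij) xy'.
Qed.

Lemma card_graft_node i : k < i -> #|graft_node i| = #|node (T ord0) i|.
Proof.
move=> ki; pose f (x : node (T ord0) i) := graft_mk x (graft_root i).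
have f_inj : injective f.
  by move=> x y /(congr1 val) /= /eqP; rewrite eq_Tagged => /eqP.
rewrite -(card_codom f_inj); apply/esym/eq_card => p; rewrite [RHS]inE.
apply/codomP; have [j [x [ij ->]]] := graft_nodeP p.
have j0 : j = ord0 by apply/eqP; move: ij; rewrite leqNgt ki.
by subst j; exists x; congr graft_mk; exact: eq_irrelevance.
Qed.

Fact graft_eventually1 : exists N, forall i, N <= i -> #|graft_node i| = 1.
Proof.
have [N TN] := node_eventually1 (T ord0); exists (maxn N k.+1) => i.
by rewrite geq_max => /andP[Ni ki]; rewrite card_graft_node // TN.
Qed.

Definition graft : fission_tree :=
  FissionTree graft_gt0 graft_surj graft_eventually1.

(** Up to the level k the graft is a disjoint union, and the code of a node
depends only on what lies below it. *)
Lemma ncode_graft i j (x : node (T j) i) (ij : (i <= k) || (j == ord0)) :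
  i <= k -> @ncode graft i (graft_mk x ij) = ncode x.
Proof.
elim: i j x ij => //= i IHi j y ij ik; congr CodeSeq.code.
apply/perm_sortP; [exact: leq_total|exact: leq_trans|exact: anti_leq|].
have ij' x : (i <= k) || (x == ord0 :> 'I_m.+1) by rewrite ltnW.
pose f x := graft_mk (x : node (T j) i) (ij' j).
suff /(perm_map (@ncode graft i))/perm_trans : perm_eq
    [seq x <- enum (node graft i) | parent x == (graft_mk y ij : node graft i.+1)]
    [seq f x | x <- enum (node (T j) i) & parent x == y].
  apply; rewrite -map_comp (@eq_map _ _ _ (@ncode (T j) i)) //= => x.
  exact: (IHi j x (ij' j) (ltnW ik)).
apply: uniq_perm; first exact/filter_uniq/enum_uniq.
  rewrite map_inj_uniq; first exact/filter_uniq/enum_uniq.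
  by move=> x x' /(congr1 val) /= /eqP; rewrite eq_Tagged => /eqP.
move=> p; rewrite mem_filter mem_enum andbT; apply/eqP/mapP.
  have [j' [x [ijx ->]]] := graft_nodeP p.
  have ijx' : (i < k) || (j' == ord0) by rewrite ik.
  rewrite /= (graft_parentE x ijx ijx') => /(congr1 val) /= xy.
  have jj' : j' = j by have := congr1 tag xy.
  subst j'; move/eqP: xy; rewrite eq_Tagged /= => xy.
  exists x; first by rewrite mem_filter xy mem_enum.
  by congr graft_mk; exact: eq_irrelevance.
case=> x; rewrite mem_filter => /andP[/eqP <- _] ->.
exact: (graft_parentE x (ij' j) ij).
Qed.
End Graft.

Definition one_leaf_tree : fission_tree.
Proof.
refine (@FissionTree (fun=> unit) (fun _ x => x) _ _ _).
- by move=> i; rewrite card_unit.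
- by move=> i y; exists y.
- by exists 0 => i _; rewrite card_unit.
Defined.

(** Writing the index set as a successor makes this a total function; for a
valid code, the predecessor of the size is a genuine one. *)
Fixpoint tree_of k c : fission_tree :=
  if k is k'.+1 then
    let s := CodeSeq.decode c in
    graft k' (fun j : 'I_(size s).-1.+1 => tree_of k' (nth 0 s j))
  else one_leaf_tree.

(** In the graft, the single node of height index k + 1 has as children the top
nodes of the grafted trees, whose codes are the entries of the list. *)
Lemma tree_ofP k c : valid k c ->
  #|node (tree_of k c) k| = 1 /\ forall x : node (tree_of k c) k, ncode x = c.
Proof.
elim: k c => [|k IHk] c /=; first by move/eqP->; rewrite card_unit.
set s := CodeSeq.decode c; move=> /and3P[s0 s_sorted s_valid].
have size_s : (size s).-1.+1 = size s by rewrite prednK // lt0n size_eq0.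
pose T (j : 'I_(size s).-1.+1) := tree_of k (nth 0 s j).
have TP (j : 'I_(size s).-1.+1) :
    #|node (T j) k| = 1 /\ forall x : node (T j) k, ncode x = nth 0 s j.
  apply/IHk/(allP s_valid)/mem_nth/(leq_trans (ltn_ord j)).
  by rewrite size_s.
have J1 : #|node (graft k T) k.+1| = 1.
  rewrite [LHS]card_graft_node //; apply/slope_leP/leqW/slope_leP.
  by case: (TP ord0).
split=> [//|y]; rewrite -[c]CodeSeq.decodeK -/s; congr CodeSeq.code.
rewrite -[RHS](sorted_sort leq_trans s_sorted).
apply/perm_sortP; [exact: leq_total|exact: leq_trans|exact: anti_leq|].
have ok (j : 'I_(size s).-1.+1) : (k <= k) || (j == ord0) by rewrite leqnn.
pose f (j : 'I_(size s).-1.+1) : node (graft k T) k :=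
  graft_mk (some_node (T j) k) (ok j).
rewrite /child_codes (@eq_filter _ _ predT) => [|x]; last first.
  by apply/eqP/card1_eq.
rewrite filter_predT.
have /(perm_map (@ncode (graft k T) k))/perm_trans :
    perm_eq (enum (node (graft k T) k)) (map f (enum 'I_(size s).-1.+1)).
  apply: uniq_perm; first exact: enum_uniq.
    rewrite map_inj_uniq; first exact: enum_uniq.
    by move=> j j' /(congr1 (fun p => tag (val p))).
  move=> p; rewrite mem_enum; apply/esym/mapP.
  have [j [x [ij ->]]] := graft_nodeP p.
  exists j; first by rewrite mem_enum.
  rewrite /f (@card1_eq _ (some_node (T j) k) x); last by case: (TP j).
  by congr graft_mk; exact: eq_irrelevance.
apply; rewrite -map_comp.
rewrite (@eq_map _ _ _ (fun j : 'I_(size s).-1.+1 => nth 0 s j)) => [|j /=].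
  rewrite (map_comp (nth 0 s) val) val_enum_ord size_s.
  by rewrite -/(mkseq _ _) mkseq_nth.
rewrite ncode_graft //; by case: (TP j).
Qed.

(** * Counting classes by counting codes *)

Definition enumerates k n (l : seq nat) : Prop :=
  uniq l /\ forall c, (c \in l) = valid k c && (weight k c == n).

(** The code of the top node gives a bijection between classes and valid
codes. *)
Lemma class_count_enum k n l : enumerates k n l -> class_count k n (size l).
Proof.
move=> [l_uniq lP]; exists (fun i : 'I_(size l) => tree_of k (nth 0 l i)).
have codeP (i : 'I_(size l)) : valid k (nth 0 l i) && (weight k (nth 0 l i) == n).
  by rewrite -lP mem_nth.
have slopeP (i : 'I_(size l)) : slope (tree_of k (nth 0 l i)) <= k.
  by have /andP[/tree_ofP[/slope_leP]] := codeP i.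
have ncodeP (i : 'I_(size l)) (x : node (tree_of k (nth 0 l i)) k) :
    ncode x = nth 0 l i.
  by have /andP[/tree_ofP[_]] := codeP i.
have leavesE T : slope T <= k -> leaves T = weight k (ncode (some_node T k)).
  move=> /slope_leP Tk; rewrite -(weight_ncode T k) (bigD1 (some_node T k)) //=.
  by rewrite big1 ?addn0 // => x; rewrite (card1_eq x (some_node T k) Tk) eqxx.
split=> [i|i j [phi [phi_bij phiP]]|T Tk Tn].
- by split=> //; rewrite leavesE // ncodeP; have /andP[_ /eqP] := codeP i.
- apply/val_inj/eqP; rewrite -(nth_uniq 0 _ _ l_uniq) //=.
  rewrite -(ncodeP i (some_node _ k)) -(ncode_iso phi_bij phiP); apply/eqP.
  exact: ncodeP.
- have : ncode (some_node T k) \in l by rewrite lP ncode_valid -leavesE // Tn /=.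
  move=> cl; have ci : index (ncode (some_node T k)) l < size l.
    by rewrite index_mem.
  exists (Ordinal ci).
  apply: (iso_of_ncode (k := k) (x := some_node T k) (x' := some_node _ k)) => //.
  by rewrite ncodeP /= nth_index.
Qed.

Lemma Phi_enum k n l : enumerates k n l -> Phi k n = size l.
Proof.
move/class_count_enum => h; apply: (class_count_uniq _ h).
exact: (@xgetPex _ 0 [set N | class_count k n N]%classic (ex_intro _ _ h)).
Qed.

(** * Multisets and geometric series *)

Local Open Scope ring_scope.

Lemma fcoef_XnM (R : comNzRingType) m (f : fps R) n :
  fcoef (fpsX R ^+ m * f) n = if (m <= n)%N then fcoef f (n - m) else 0.
Proof.
rewrite -[LHS]/(\sum_(i < n.+1) fcoef (fpsX R ^+ m) i * fcoef f (n - i)).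
have [mn|nm] := leqP m n; last first.
  rewrite big1 // => i _.
  by rewrite fcoefXn (ltn_eqF (leq_ltn_trans _ nm)) ?mul0r // -ltnS.
rewrite (bigD1 (Ordinal (mn : (m < n.+1)%N))) //= big1 => [|i im]; last first.
  by rewrite fcoefXn (negPf (im : (i : nat) != m)) mul0r.
by rewrite fcoefXn eqxx mul1r addr0.
Qed.

(** Division by 1 - u^m, as a recurrence: g = f / (1 - u^m) solves
g = f + u^m g. *)
Lemma fcoef_geomM (R : comNzRingType) m (f : fps R) n : (0 < m)%N ->
  fcoef ((1 - fpsX R ^+ m)^-1 * f) n =
  fcoef f n + (if (m <= n)%N then fcoef ((1 - fpsX R ^+ m)^-1 * f) (n - m) else 0).
Proof.
move=> m0; set g := _^-1 * f; rewrite -fcoef_XnM.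
suff {1}-> : g = f + fpsX R ^+ m * g by [].
by apply/eqP; rewrite -subr_eq -{1}[g]mul1r -mulrBl mulVKr ?fps_unit_1subXn.
Qed.

(** Multisets over vs are represented by sorted lists. Those of weight n over
v :: vs either avoid v, and are multisets over vs, or arise by adding v to one
of weight n - w v; as v is the least element, adding it keeps a list sorted.
This is the recurrence [fcoef_geomM] for the coefficients of the product. *)
Lemma enum_multisets (w : nat -> nat) vs n :
    sorted ltn vs -> all (fun v => (0 < w v)%N) vs ->
  exists l : seq (seq nat),
    [/\ uniq l,
        forall s, (s \in l) =
          [&& sorted leq s, all (mem vs) s & sumn (map w s) == n]
      & Posz (size l) = fcoef (\prod_(v <- vs) (1 - fpsX int ^+ w v)^-1) n].
Proof.
elim: vs n => [|v vs IHvs] n /=.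
  (* The empty product 1 counts the empty multiset. *)
  move=> _ _; exists (if n == 0%N then [:: [::]] else [::]).
  rewrite big_nil; case: n => [|n]; split=> // -[|x s] //=;
    by rewrite andbF.
move=> v_vs /andP[v0 vs0].
have vs_sorted := path_sorted v_vs.
have v_lt u : u \in vs -> (v < u)%N.
  by move: v_vs; rewrite (path_sortedE ltn_trans) => /andP[/allP + _]; apply.
rewrite big_cons; elim/ltn_ind: n => n IHn.
have [l [l_uniq lP sz_l]] := IHvs n vs_sorted vs0.
have lNv s : s \in l -> v \notin s.
  rewrite lP => /and3P[_ /allP s_vs _]; apply/negP => /s_vs /= /v_lt.
  by rewrite ltnn.
have NvE s : v \notin s -> all (mem (v :: vs)) s = all (mem vs) s.
  move=> vs'; apply: eq_in_all => x xs /=; rewrite inE; case: eqP => // xv.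
  by rewrite xv (negPf vs') in xs *.
have [vn|nv] := leqP (w v) n; last first.
  exists l; split=> // [s|]; last by rewrite fcoef_geomM // leqNgt nv addr0.
  rewrite lP; case: (boolP (v \in s)) => [vs'|/NvE -> //].
  have -> : (sumn (map w s) == n) = false.
    apply/gtn_eqF/(leq_trans nv); rewrite sumnE big_map (big_rem v) //=.
    exact: leq_addr.
  by rewrite !andbF.
have lt_n : (n - w v < n)%N by rewrite ltn_subrL v0 (leq_trans v0).
have [l' [l'_uniq l'P sz_l']] := IHn _ lt_n.
exists (l ++ map (cons v) l'); split.
- rewrite cat_uniq l_uniq map_inj_uniq ?l'_uniq ?andbT /= => [|s t [] //].
  by apply/hasPn => _ /mapP[s _ ->]; apply/negP => /lNv; rewrite mem_head.
- move=> s; rewrite mem_cat; case: (boolP (v \in s)) => [vs'|/[dup] vs' /NvE ->].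
    rewrite (contraTF (@lNv s)) ?negbK //=; apply/mapP/and3P.
      move=> [t + ->]; rewrite l'P => /and3P[t_sorted t_vs /eqP tn].
      rewrite /= inE eqxx t_vs tn subnKC //; split=> //.
      rewrite (path_sortedE leq_trans) t_sorted andbT; apply: sub_all t_vs => u.
      by rewrite inE => /predU1P[->//|/v_lt/ltnW].
    case: s vs' => // u s us [s_sorted /= /andP[uv s_vs] /eqP sn].
    have uE : u = v.
      apply/eqP; rewrite eqn_leq; apply/andP; split.
        move: us; rewrite inE => /predU1P[->//|].
        move: s_sorted; rewrite /= (path_sortedE leq_trans) => /andP[/allP + _].
        exact.
      by move: uv; rewrite inE => /predU1P[->//|/v_lt/ltnW].
    exists s; last by rewrite uE.
    by rewrite l'P s_vs (path_sorted s_sorted) -sn uE addKn eqxx.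
  rewrite lP; case: mapP => [[t _ st]|_]; last by rewrite orbF.
  by rewrite st mem_head in vs'.
- by rewrite size_cat size_map PoszD sz_l sz_l' [RHS]fcoef_geomM // vn.
Qed.

(** * The Euler transform *)

Lemma uniq_flatten_graded (w : nat -> nat) (E : nat -> seq nat) r :
    (forall m, uniq (E m)) -> (forall m c, c \in E m -> w c = m) ->
  uniq r -> uniq (flatten (map E r)).
Proof.
move=> E_uniq wE; elim: r => //= m r IHr /andP[mr r_uniq].
rewrite cat_uniq E_uniq IHr // andbT; apply/hasPn => c.
case/flattenP => _ /mapP[m' m'r ->] /wE cm'; apply/negP => /wE cm.
by rewrite -cm cm' m'r in mr.
Qed.

Lemma prod_graded (w : nat -> nat) (E : nat -> seq nat) r :
    (forall m c, c \in E m -> w c = m) ->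
  \prod_(c <- flatten (map E r)) (1 - fpsX int ^+ w c)^-1 =
  \prod_(m <- r) (1 - fpsX int ^+ m) ^ (- Posz (size (E m))).
Proof.
move=> wE; rewrite big_flatten big_map; apply: eq_bigr => m _.
rewrite big_seq (eq_bigr (fun=> (1 - fpsX int ^+ m)^-1)) => [|c /wE -> //].
by rewrite -big_seq big_const_seq count_predT iter_mulr_1 -exprnN exprVn.
Qed.

(** The members of a multiset of weight n < N have weight less than N, so all of
them come from the finite list of valid codes of weights 1, ..., N - 1. *)
Lemma enum_valid_seqs k (E : nat -> seq nat) n N :
    (forall m, enumerates k m (E m)) -> (n < N)%N ->
  exists l : seq (seq nat),
    [/\ uniq l,
        forall s, (s \in l) =
          [&& sorted leq s, all (valid k) s & sumn (map (weight k) s) == n]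
      & Posz (size l) =
        fcoef (\prod_(1 <= m < N) (1 - fpsX int ^+ m) ^ (- Posz (size (E m)))) n].
Proof.
move=> EP nN; pose vs := flatten (map E (index_iota 1 N)).
have wE m c : c \in E m -> weight k c = m by rewrite (EP m).2 => /andP[_ /eqP].
have vs_uniq : uniq vs.
  by apply: uniq_flatten_graded wE _; [move=> m; case: (EP m)|exact: iota_uniq].
have vsP c : (c \in vs) = valid k c && (weight k c < N)%N.
  apply/flattenP/andP => [[_ /mapP[m + ->]]|[cv cN]].
    by rewrite mem_index_iota (EP m).2 => /andP[_ mN] /andP[-> /eqP->].
  exists (E (weight k c)); last by rewrite (EP _).2 cv eqxx.
  by apply: map_f; rewrite mem_index_iota weight_gt0.
have [||l [l_uniq lP sz_l]] := @enum_multisets (weight k) (sort leq vs) n.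
- by rewrite ltn_sorted_uniq_leq sort_uniq vs_uniq sort_sorted //; exact: leq_total.
- by rewrite all_sort; apply/allP => c; rewrite vsP => /andP[/weight_gt0].
exists l; split=> // [s|].
  rewrite lP; case: (sorted leq s) => //=.
  case: eqP => [sn|]; last by rewrite !andbF.
  rewrite !andbT; apply: eq_in_all => c cs /=; rewrite mem_sort vsP.
  rewrite (leq_ltn_trans _ nN) ?andbT // -sn sumnE big_map (big_rem c) //=.
  exact: leq_addr.
by rewrite sz_l (perm_big _ (permEl (perm_sort _ _))) prod_graded.
Qed.

Lemma enumerates_succ k n (l : seq (seq nat)) :
    uniq l ->
    (forall s, (s \in l) =
       [&& sorted leq s, all (valid k) s & sumn (map (weight k) s) == n]) ->
  enumerates k.+1 n [seq CodeSeq.code s | s <- l & s != [::]].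
Proof.
move=> l_uniq lP; split.
  by rewrite (map_inj_uniq (can_inj CodeSeq.codeK)) filter_uniq.
move=> c; rewrite -[c in LHS]CodeSeq.decodeK (mem_map (can_inj CodeSeq.codeK)).
by rewrite mem_filter lP /= !andbA.
Qed.

Lemma exists_enumeration k :
  exists E : nat -> seq nat, forall n, enumerates k n (E n).
Proof.
elim: k => [|k [E EP]].
  exists (fun n => if n == 1%N then [:: 0%N] else [::]) => n.
  split=> [|c]; first by case: ifP.
  rewrite /= [1%N == n]eq_sym; case: eqP => _; last by rewrite andbF.
  by rewrite inE andbT.
suff /choice[E' E'P] : forall n, exists l, enumerates k.+1 n l by exists E'.
move=> n; have [l [l_uniq lP _]] := enum_valid_seqs EP (ltnSn n).
by exists [seq CodeSeq.code s | s <- l & s != [::]]; exact: enumerates_succ.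
Qed.

Lemma class_count_Phi k n : class_count k n (Phi k n).
Proof.
have [E EP] := exists_enumeration k.
by rewrite (Phi_enum (EP n)); exact: class_count_enum.
Qed.

(** The coefficient counts all multisets of weight n. The empty one, which is
not the code of a node, has weight 0 and is the only one of that weight: it
accounts for the constant term 1. *)
Lemma Phi_euler k n N : (n < N)%N ->
  fcoef (\prod_(1 <= m < N) (1 - fpsX int ^+ m) ^ (- Posz (Phi k m))) n =
  if n == 0%N then 1 else Posz (Phi k.+1 n).
Proof.
move=> nN; have [E EP] := exists_enumeration k.
have [l [l_uniq lP]] := enum_valid_seqs EP nN.
under eq_bigr => m _ do rewrite -(Phi_enum (EP m)).
move=> <-; case: eqP => [n0|/eqP n0].
  suff /perm_size-> : perm_eq l [:: [::]] by [].
  apply: uniq_perm => // s; rewrite lP inE n0.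
  case: s => [|c s] //=; apply/negbTE/negP => /and3P[_ /andP[/weight_gt0 c0 _]].
  by rewrite addn_eq0 gtn_eqF.
rewrite (Phi_enum (enumerates_succ l_uniq lP)) size_map (@eq_in_filter _ _ predT).
  by rewrite filter_predT.
by move=> s; rewrite lP; case: s => //= /eqP n_eq0; rewrite -n_eq0 in n0.
Qed.

(** A node of height index 1 has only leaves of code 0 below it, so its code is
a constant list. *)
Lemma Phi1 m : (0 < m)%N -> Phi 1 m = 1%N.
Proof.
move=> m0; rewrite (@Phi_enum _ _ [:: CodeSeq.code (nseq m 0%N)]) //.
split=> // c; rewrite inE -[c in LHS]CodeSeq.decodeK.
rewrite (inj_eq (can_inj CodeSeq.codeK)) /=; set s := CodeSeq.decode c.
have -> : sumn [seq 1%N | _ <- s] = size s.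
  by rewrite sumnE big_map sum1_size.
apply/eqP/andP => [->|[/and3P[_ _ /all_pred1P->] /eqP <-]].
  rewrite size_nseq eqxx -size_eq0 size_nseq -lt0n m0 /= all_nseq orbT andbT.
  by split=> //; apply/(sortedP 0%N) => i _; rewrite !nth_nseq !if_same.
by rewrite size_nseq.
Qed.

(** Partitions are listed in nonincreasing order, multisets in nondecreasing
order, whence the reversal. *)
Lemma Phi2_partitions n : (0 < n)%N -> Phi 2 n = npartitions n.
Proof.
move=> n0; have := @Phi_euler 1 n n.+1 (ltnSn n); rewrite gtn_eqF //.
have [||l [l_uniq lP sz_l]] := @enum_multisets id (index_iota 1 n.+1) n.
- exact: iota_ltn_sorted.
- by apply/allP => i; rewrite mem_index_iota => /andP[].
rewrite (eq_big_nat _ _ (F2 := fun m => (1 - fpsX int ^+ m)^-1)); last first.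
  by move=> m /andP[m0 _]; rewrite Phi1.
rewrite -sz_l => -[<-]; rewrite -(size_map rev).
rewrite /npartitions; apply/perm_size/uniq_perm.
- by rewrite (map_inj_uniq (can_inj revK)).
- exact: fset_uniq.
move=> s; rewrite -[s in LHS]revK (mem_map (can_inj revK)) lP.
rewrite in_fset_set; last exact: finite_partition.
apply/and3P/idP => [[]|].
  rewrite map_id rev_sorted sumn_rev all_rev => s_sorted s_pos /eqP sn.
  rewrite inE; split=> //; apply/negP => /(allP s_pos) /=.
  by rewrite mem_index_iota.
rewrite inE => -[s_sorted s0 sn]; rewrite map_id rev_sorted sumn_rev all_rev.
split=> //; last exact/eqP.
apply/allP => i si /=; rewrite mem_index_iota lt0n (contraNneq _ s0) /=.
  by rewrite ltnS -sn sumnE (big_rem i) //= leq_addr.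
by move=> <-.
Qed.

Theorem lemma4 :
  (forall k n : nat, class_count k n (Phi k n)) /\
  (forall n : nat, (1 <= n)%N -> Phi 2 n = npartitions n) /\
  (forall k : nat, (1 <= k)%N ->
     is_euler_transform (fun n => Posz (Phi (k - 1)%N n))
                        (fun n => Posz (Phi k n))).
Proof.
split; first exact: class_count_Phi.
split; first exact: Phi2_partitions.
case=> // k _ n; exists n.+1 => N nN.
by rewrite subn1 Phi_euler.
Qed.
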